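(* Let $t<0$ and $c\in\mathbb{T}$. Then $p_c(t)=\infty$ if and only if $c\in\mathcal{C}_\infty$.
   Context: $\mathbb{T}=\mathbb{R}/\mathbb{Z}$ is the torus with the doubling map $T\colon x\mapsto 2x \pmod 1$. For $c\in\mathbb{T}$, $\psi_c\colon\mathbb{T}\to[-\infty,+\infty)$ is $\psi_c(x)=2\log(|\sin(\pi(x-c))|)$, with $\log 0=-\infty$. $\mathcal{M}$ is the set of $T$-invariant Borel probability measures on $\mathbb{T}$, and $\mathcal{M}_c\subset\mathcal{M}$ is the set of those $\mu\in\mathcal{M}$ whose support does not contain $c$. $h(\mu)$ is the measure-theoretic (Kolmogorov–Sinai) entropy of $\mu$ with respect to $T$ (natural logarithm). The pressure is $p_c(t)=\sup_{\mu\in\mathcal{M}_c}\left(h(\mu)+\int t\psi_c\,\mathrm{d}\mu\right)\in(-\infty,+\infty]$. Set $\alpha(c)=\inf_{\mu\in\mathcal{M}}\int\psi_c\,\mathrm{d}\mu\in[-\infty,0]$ (infimum over all of $\mathcal{M}$) and $\mathcal{C}_\infty=\{c\in\mathbb{T}:\alpha(c)=-\infty\}$. *)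

(* Defs.v *)
From HB Require Import structures.
From mathcomp Require Import all_boot all_order all_algebra.
From mathcomp Require Import generic_quotient ring_quotient.
From mathcomp Require Import all_classical all_reals all_analysis.

Set Implicit Arguments.
Unset Strict Implicit.
Unset Printing Implicit Defensive.

Import Order.TTheory GRing.Theory Num.Theory.
Import numFieldNormedType.Exports.

Local Open Scope classical_set_scope.
Local Open Scope ring_scope.
Local Open Scope quotient_scope.

Section entropy.
Context d (X : measurableType d) (R : realType).
Variables (mu : probability X R) (T : X -> X).

(* A finite partition is encoded by its labelling function [xi : X -> J], its
   cells being the (possibly empty) fibres of [xi]. *)
Definition measurable_partition (J : finType) (xi : X -> J) : Prop :=
  forall j, measurable (xi @^-1` [set j]).

(* The convention 0 log 0 = 0 holds because of the factor 0. *)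
Definition partition_entropy (J : finType) (xi : X -> J) : R :=
  - \sum_(j : J) (let p := fine (mu (xi @^-1` [set j])) in p * ln p).

(* The join of xi, T^-1 xi, ..., T^-(n-1) xi: a point is labelled by its
   itinerary of length n. *)
Definition iterated_join (J : finType) (xi : X -> J) (n : nat) :
    X -> {ffun 'I_n -> J} :=
  fun x => [ffun i : 'I_n => xi (iter i T x)].

Definition partition_entropy_rate (J : finType) (xi : X -> J) : R :=
  limn (fun n : nat => partition_entropy (iterated_join xi n) / n%:R).

Definition ks_entropy : \bar R :=
  ereal_sup [set z | exists (k : nat) (xi : X -> 'I_k),
    measurable_partition xi /\ z = (partition_entropy_rate xi)%:E].

Definition invariant_measure : Prop :=
  forall A, measurable A -> mu (T @^-1` A) = mu A.

End entropy.

(* The quotient group R/Z; [Num.int_num_subdef] is the predicate underlying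
   [Num.int], which carries the subgroup structure. *)
Definition torus (R : realType) : Type :=
  @Quotient.quot R (Num.int_num_subdef : {pred R}).

Section torus_structures.
Variable R : realType.

HB.instance Definition _ := EqQuotient.on (torus R).
HB.instance Definition _ := GRing.Zmodule.on (torus R).
HB.instance Definition _ := isPointed.Build (torus R) 0.

(* [quotient_topology] is not reused: its choice structure differs from the one
   carried by the quotient group. *)
Definition torus_open (U : set (torus R)) : Prop :=
  open ((\pi_(torus R) : R -> torus R) @^-1` U).

Let torus_openT : torus_open setT.
Proof. by rewrite /torus_open preimage_setT; exact: openT. Qed.

Let torus_openI (U V : set (torus R)) :
  torus_open U -> torus_open V -> torus_open (U `&` V).
Proof. exact: openI. Qed.

Let torus_open_bigcup (I : Type) (f : I -> set (torus R)) :
  (forall i, torus_open (f i)) -> torus_open (\bigcup_i f i).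
Proof. by move=> fo; apply: bigcup_open => i _; exact: fo. Qed.

HB.instance Definition _ :=
  isOpenTopological.Build (torus R) torus_openT torus_openI torus_open_bigcup.

HB.instance Definition _ :=
  Measurable.copy (torus R) (g_sigma_algebraType (@open (torus R))).

End torus_structures.

Section thermodynamics.
Variable R : realType.
Implicit Types (c x : torus R) (mu : probability (torus R) R).

Definition doubling x : torus R := x *+ 2.

(* |sin (pi y)| has period 1 in y, so the choice of the representative of x - c
   is immaterial; [lne 0 = -oo]. *)
Definition psi c x : \bar R :=
  (2%:E * lne `|sin (pi * repr (x - c))|%:E)%E.

Definition measure_support mu : set (torus R) :=
  [set x | forall U, open U -> U x -> (0 < mu U)%E].

Definition inv_measures : set (probability (torus R) R) :=
  [set mu | invariant_measure mu doubling].

Definition inv_measures_avoiding c : set (probability (torus R) R) :=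
  [set mu | inv_measures mu /\ ~ measure_support mu c].

Definition pressure c (t : R) : \bar R :=
  ereal_sup [set (ks_entropy mu doubling
                  + \int[mu]_x (t%:E * psi c x))%E | mu in inv_measures_avoiding c].

Definition alpha c : \bar R :=
  ereal_inf [set (\int[mu]_x psi c x)%E | mu in inv_measures].

Definition C_infty : set (torus R) := [set c | alpha c = -oo%E].

End thermodynamics.

(* Main.v *)
Require Import Defs.
From HB Require Import structures.
From mathcomp Require Import all_boot all_order all_algebra.
From mathcomp Require Import generic_quotient ring_quotient.
From mathcomp Require Import all_classical all_reals all_analysis.
From mathcomp Require Import measurable_realfun.
From mathcomp Require Import lra zify.

(* Since [t * psi c >= 0], only two facts are needed.

   The entropy of the doubling map is bounded uniformly over invariant
   measures, so an infinite pressure forces [int psi c] to be unbounded below.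
   The bound (3 ln 2 + 1, not the optimal ln 2) needs no conditional entropy: a
   partition agrees, off a set of small measure, with a function of finitely
   many binary digits, so its itineraries of length n can be guessed from
   2^(m + n) dyadic labels, and Gibbs' inequality against the corresponding
   mixture of product weights bounds the entropy of the iterated join.

   Conversely, if [int psi c dmu] is very negative, then so is the integral of
   a Lipschitz truncation of [psi c], hence some orbit segment of length N has a
   very negative Birkhoff average. A nearby point k / (2^N - 1) is periodic and
   shadows the segment with an error independent of N. Two consecutive
   numerators k are admissible and, for N large, the orbit of one of the two
   points avoids c, so its orbit measure competes in the pressure. *)

Set Implicit Arguments.
Unset Strict Implicit.
Unset Printing Implicit Defensive.

Import Order.TTheory GRing.Theory Num.Theory.
Import numFieldNormedType.Exports.
Local Open Scope classical_set_scope.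
Local Open Scope ring_scope.

(** * Entropy bound from a refining sequence of labels *)

Definition saturated (X : Type) (eta : nat -> X -> nat) (m : nat) (D : set X) : Prop :=
  forall x y, eta m x = eta m y -> D x -> D y.

(** Up to measurable sets of arbitrarily small measure, [A] is a union of label cells of some level.
    Measurability of [A] is built in because closure under countable unions rests on the continuity
    of [mu]. *)
Definition approximable d (X : measurableType d) (R : realType)
    (mu : probability X R) (eta : nat -> X -> nat) (A : set X) : Prop :=
  measurable A /\ forall e : R, 0 < e -> exists m D E,
    [/\ saturated eta m D, measurable E, (mu E < e%:E)%E
      & forall x, ~ E x -> (A x <-> D x)].

Definition refining (X : Type) (eta : nat -> X -> nat) : Prop :=
  forall m x y, eta m.+1 x = eta m.+1 y -> eta m x = eta m y.

Lemma refining_le (X : Type) (eta : nat -> X -> nat) (m n : nat) (x y : X) :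
  refining eta -> (m <= n)%N -> eta n x = eta n y -> eta m x = eta m y.
Proof.
move=> eta_ref; elim: n => [|n IHn]; first by rewrite leqn0 => /eqP->.
by rewrite leq_eqVlt ltnS => /predU1P[-> //|/IHn {}IHn /eta_ref].
Qed.

Lemma saturated_le (X : Type) (eta : nat -> X -> nat) (m n : nat) (D : set X) :
  refining eta -> (m <= n)%N -> saturated eta m D -> saturated eta n D.
Proof. by move=> eta_ref mn satD x y /(refining_le eta_ref mn); exact: satD. Qed.

Lemma approximableC d (X : measurableType d) (R : realType)
    (mu : probability X R) (eta : nat -> X -> nat) (A : set X) :
  approximable mu eta A -> approximable mu eta (~` A).
Proof.
move=> [mA apA]; split=> [|e /apA[m [D [E [satD mE muE AD]]]]]; first exact: measurableC.
exists m, (~` D), E; split=> // [x y xy Dx Dy|x /AD[AD1 AD2]].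
  exact/Dx/(satD y).
by split=> nAx; [move/AD2|move/AD1].
Qed.

Lemma approximable0 d (X : measurableType d) (R : realType)
    (mu : probability X R) (eta : nat -> X -> nat) : approximable mu eta set0.
Proof.
split=> // e e0; exists 0%N, set0, set0; split=> //.
by rewrite measure0 lte_fin.
Qed.

Lemma approximableU d (X : measurableType d) (R : realType)
    (mu : probability X R) (eta : nat -> X -> nat) (A B : set X) :
  refining eta -> approximable mu eta A -> approximable mu eta B ->
  approximable mu eta (A `|` B).
Proof.
move=> eta_ref [mA apA] [mB apB]; split=> [|e e0]; first exact: measurableU.
have e20 : 0 < e / 2 by rewrite divr_gt0.
have [m [D [E [satD mE muE AD]]]] := apA _ e20.
have [n [D' [E' [satD' mE' muE' AD']]]] := apB _ e20.
exists (maxn m n), (D `|` D'), (E `|` E'); split.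
- have sD := saturated_le eta_ref (leq_maxl m n) satD.
  have sD' := saturated_le eta_ref (leq_maxr m n) satD'.
  by move=> x y xy [/(sD _ _ xy)|/(sD' _ _ xy)]; [left|right].
- exact: measurableU.
- rewrite (le_lt_trans (measureU2 _ mE mE'))// (splitr e) EFinD.
  exact: lteD.
- move=> x /not_orP[/AD[? ?] /AD'[? ?]].
  by split=> -[]; [left|right|left|right]; auto.
Qed.

(** The part of the union missed by the first [n] sets decreases to the empty set, so its measure
    falls below [e / 2] for some [n]; the finite union [B n] is then approximated within [e / 2]. *)
Lemma approximable_bigcup d (X : measurableType d) (R : realType)
    (mu : probability X R) (eta : nat -> X -> nat) (A : (set X)^nat) :
  refining eta -> (forall n, approximable mu eta (A n)) ->
  approximable mu eta (\bigcup_n A n).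
Proof.
move=> eta_ref apA.
have mA n : measurable (A n) by case: (apA n).
split=> [|e e0]; first exact: bigcupT_measurable.
pose B n := \big[setU/set0]_(i < n) A i.
have apB n : approximable mu eta (B n).
  rewrite /B; elim/big_ind: _ => // [|C D]; first exact: approximable0.
  exact: approximableU.
have mB n : measurable (B n) by case: (apB n).
have ndB : {homo (fun n => \bigcup_k A k `\` B n) : n m / (n <= m)%N >-> (m `<=` n)}.
  move=> m n mn x [Ax nBx]; split=> // Bx; apply: nBx.
  by move: Bx; apply: subset_bigsetU.
have : (mu \o (fun n => \bigcup_k A k `\` B n)) @ \oo -->
    mu (\bigcap_n (\bigcup_k A k `\` B n)).
  apply: nonincreasing_cvg_mu.
  - by rewrite (le_lt_trans (probability_le1 _ _)) ?ltry//; apply: measurableD => //;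
      exact: bigcupT_measurable.
  - by move=> n; apply: measurableD => //; exact: bigcupT_measurable.
  - by apply: bigcapT_measurable => n; apply: measurableD => //; exact: bigcupT_measurable.
  - by move=> m n mn; apply/subsetPset/ndB.
have -> : \bigcap_n (\bigcup_k A k `\` B n) = set0.
  apply/seteqP; split=> // x Bx; have [[k _ Akx] _] := Bx 0%N I.
  by have [_] := Bx k.+1 I; apply; rewrite /B big_ord_recr/=; right.
rewrite measure0 => cvg0.
have e20 : 0 < e / 2 by rewrite divr_gt0.
have [n muBn] : exists n, (mu (\bigcup_k A k `\` B n) < (e / 2)%:E)%E.
  have e20' : (0 < (e / 2)%:E)%E by rewrite lte_fin.
  by have [n _ /(_ n (leqnn n))] := cvg0 _ (open_ereal_lt' e20'); exists n.
have [_ /(_ _ e20)[m [D [E [satD mE muE AD]]]]] := apB n.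
have mAB : measurable (\bigcup_k A k `\` B n).
  by apply: measurableD => //; exact: bigcupT_measurable.
exists m, D, (E `|` (\bigcup_k A k `\` B n)); split=> //.
- exact: measurableU.
- by rewrite (le_lt_trans (measureU2 _ mE mAB))// (splitr e) EFinD lteD.
- move=> x /not_orP[/AD[BD DB] nAB]; split=> [Ax|/DB]; last first.
    by rewrite /B -bigcup_mkord => -[k _ Akx]; exists k.
  by apply: BD; apply: contrapT => nBx; apply: nAB.
Qed.

Lemma approximable_sigma_algebra d (X : measurableType d) (R : realType)
    (mu : probability X R) (eta : nat -> X -> nat) :
  refining eta -> sigma_algebra setT (approximable mu eta).
Proof.
move=> eta_ref; split=> [|A|A apA]; first exact: approximable0.
  by rewrite setTD; exact: approximableC.
exact: approximable_bigcup.
Qed.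

(** Each cell is approximated within [e / k], and the levels are raised to their maximum. [xi']
    picks an index whose approximating set contains the point: off [E] the only such index is
    [xi x], and [j0] is the default for points in no approximating set. *)
Lemma approximable_labelling d (X : measurableType d) (R : realType)
    (mu : probability X R) (eta : nat -> X -> nat) k (j0 : 'I_k)
    (xi : X -> 'I_k) (e : R) :
  refining eta -> (forall j, approximable mu eta (xi @^-1` [set j])) -> 0 < e ->
  exists m (xi' : X -> 'I_k) E,
    [/\ forall x y, eta m x = eta m y -> xi' x = xi' y,
        measurable E, (mu E <= e%:E)%E & forall x, ~ E x -> xi x = xi' x].
Proof.
move=> eta_ref apxi e0.
have k0 : 0 < k%:R :> R by rewrite ltr0n (leq_trans _ (ltn_ord j0)).
have ek0 : 0 < e / k%:R by rewrite divr_gt0.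
have /choice[m /choice[D /choice[E mDE]]] : forall j, exists m D E,
    [/\ saturated eta m D, measurable E, (mu E < (e / k%:R)%:E)%E
      & forall x, ~ E x -> ((xi @^-1` [set j]) x <-> D x)].
  by move=> j; have [_] := apxi j; exact.
exists (\max_j m j), (fun x => odflt j0 [pick j | `[< D j x >]]),
  (\big[setU/set0]_j E j); split.
- have DE j x y : eta (\max_j m j) x = eta (\max_j m j) y -> D j x -> D j y.
    have [satD _ _ _] := mDE j.
    exact/(saturated_le eta_ref _ satD)/leq_bigmax.
  move=> x y xy; congr odflt; apply: eq_pick => j.
  by apply/asboolP/asboolP; exact: DE.
- by apply: bigsetU_measurable => j _; have [] := mDE j.
- have -> : e = \sum_(j < k) e / k%:R.
    by rewrite sumr_const card_ord -mulrnAr -mulr_natr mulVf ?mulr1// gt_eqF.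
  have : measurable (\big[setU/set0]_j E j) /\
    (mu (\big[setU/set0]_j E j) <= (\sum_(j < k) e / k%:R)%:E)%E; last by case.
  apply: (big_ind2 (fun A r => measurable A /\ (mu A <= r%:E)%E)).
  + by rewrite measure0.
  + move=> A r B s [mA Ar] [mB Bs]; split; first exact: measurableU.
    by rewrite (le_trans (measureU2 _ mA mB))// EFinD leeD.
  + by move=> j _; have [_ mEj /ltW] := mDE j.
- move=> x nEx.
  have nE j : ~ E j x by move=> Ejx; apply: nEx; rewrite (bigD1 j)//=; left.
  case: pickP => [j /asboolP Dj|/(_ (xi x))/asboolP]; last first.
    by have [_ _ _ /(_ x (nE _))[+ _] nD] := mDE (xi x) => /(_ erefl).
  by have [_ _ _ /(_ x (nE _))[_]] := mDE j; exact.
Qed.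

(** * Gibbs' inequality and integrals of finite labellings *)

Lemma ln_prod (R : realType) (I : Type) (s : seq I) (F : I -> R) :
  (forall i, 0 < F i) -> ln (\prod_(i <- s) F i) = \sum_(i <- s) ln (F i).
Proof.
move=> F0; elim: s => [|i s IHs]; first by rewrite !big_nil ln1.
by rewrite !big_cons lnM ?posrE ?prodr_gt0// IHs.
Qed.

(** Termwise, [ln u <= u - 1] at [u = q j / p j] bounds the difference of the two sides by
    [q j - p j]; where [p j = 0] that difference is 0. *)
Lemma gibbs (R : realType) (J : finType) (p q : J -> R) :
  (forall j, 0 <= p j) -> (forall j, 0 < q j) -> \sum_j q j <= \sum_j p j ->
  - \sum_j p j * ln (p j) <= \sum_j p j * - ln (q j).
Proof.
move=> p0 q0 qp; rewrite -sumrN -subr_le0 -sumrB.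
rewrite (le_trans (y := \sum_j (q j - p j)))//; last by rewrite sumrB subr_le0.
apply: ler_sum => j _; have [->|pj0] := eqVneq (p j) 0.
  by rewrite !(mul0r, oppr0, addr0, subr0) ltW.
have {}pj0 : 0 < p j by rewrite lt_def pj0/=.
have := @le_ln1Dx R (q j / p j - 1).
rewrite [1 + _]addrC subrK ln_div ?posrE// ltrBrDr addNr divr_gt0// => /(_ isT) H.
have := ler_wpM2l (ltW pj0) H; rewrite !mulrBr mulr1 mulrCA divff ?gt_eqF// mulr1.
lra.
Qed.

Section indic.
Context d (X : measurableType d) (R : realType) (mu : probability X R).
Context (I : Type) (s : seq I) (b : I -> R) (A : I -> set X).
Hypotheses (b0 : forall i, 0 <= b i) (mA : forall i, measurable (A i)).

Lemma measurable_sum_indic :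
  measurable_fun setT (fun x => \sum_(i <- s) b i * \1_(A i) x : R).
Proof.
apply/measurable_sum => i.
by apply: measurable_funM => //; exact: measurable_indic.
Qed.

Lemma integral_sum_indic :
  (\int[mu]_x (\sum_(i <- s) b i * \1_(A i) x)%:E =
   (\sum_(i <- s) b i * fine (mu (A i)))%:E)%E.
Proof.
under eq_integral do rewrite -sumEFin.
rewrite ge0_integral_sum//.
- rewrite -sumEFin; apply: eq_bigr => i _.
  rewrite (integralZl_indic _ (fun=> A i))//.
    by rewrite integral_indic// setIT EFinM fineK// fin_num_measure.
  by rewrite ltNge b0.
- move=> i; apply/measurable_EFinP.
  by apply: measurable_funM => //; exact: measurable_indic.
- by move=> i x _; rewrite lee_fin mulr_ge0.
Qed.

End indic.

Lemma invariant_iter d (X : measurableType d) (R : realType)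
    (mu : probability X R) (T : X -> X) (n : nat) (A : set X) :
  measurable_fun setT T -> invariant_measure mu T -> measurable A ->
  measurable (iter n T @^-1` A) /\ mu (iter n T @^-1` A) = mu A.
Proof.
move=> mT muT mA; elim: n => [//|n [mn IHn]].
have -> : iter n.+1 T @^-1` A = T @^-1` (iter n T @^-1` A).
  by apply/seteqP; split=> x; rewrite /preimage /mkset iterSr.
by rewrite muT//; split=> //; rewrite -[_ @^-1` _]setTI; exact: mT.
Qed.

(** Turns a function of the label into a finite sum of indicators, from which its measurability and
    its integral are read off. *)
Lemma label_sum_indic (X : Type) (R : realType) (J : finType) (xi : X -> J)
    (f : J -> R) x : f (xi x) = \sum_j f j * \1_(xi @^-1` [set j]) x.
Proof.
rewrite (bigD1 (xi x))//= indicE mem_set// mulr1 big1 ?addr0// => j jx.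
by rewrite indicE memNset ?mulr0// => /= /esym/eqP; exact/negP.
Qed.

(** Gibbs' inequality with the right side written as an integral, so that it can be bounded
    pointwise in [x]. *)
Lemma partition_entropy_le d (X : measurableType d) (R : realType)
    (mu : probability X R) (J : finType) (xi : X -> J) (q : J -> R) :
  measurable_partition xi -> (forall j, 0 < q j) -> \sum_j q j <= 1 ->
  ((partition_entropy mu xi)%:E <= \int[mu]_x (- ln (q (xi x)))%:E)%E.
Proof.
move=> mxi q0 q1.
pose p j := fine (mu (xi @^-1` [set j])).
have p0 j : 0 <= p j by rewrite fine_ge0.
have p1 : \sum_j p j = 1.
  have := @integral_sum_indic _ _ _ mu _ (index_enum J) (fun=> 1)
    (fun j => xi @^-1` [set j]) (fun=> ler01) mxi.
  under eq_integral do rewrite -(label_sum_indic xi (fun=> 1)).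
  rewrite integral_cst//= probability_setT mule1 => -[->].
  by apply: eq_bigr => j _; rewrite mul1r.
have lnq j : 0 <= - ln (q j).
  by rewrite oppr_ge0 ln_le0// (le_trans _ q1)// (bigD1 j)//= lerDl sumr_ge0// => i _; exact: ltW.
under eq_integral do rewrite (label_sum_indic xi (fun j => - ln (q j))).
rewrite integral_sum_indic// lee_fin.
rewrite (le_trans (gibbs p0 q0 _)) ?p1//.
by under eq_bigr do rewrite mulrC.
Qed.

(** * Entropy of itineraries *)

Section entropy_bound.
Context d (X : measurableType d) (R : realType) (mu : probability X R).
Variable T : X -> X.
Hypotheses (mT : measurable_fun setT T) (muT : invariant_measure mu T).

Lemma iterated_join_measurable (J : finType) (xi : X -> J) n :
  measurable_partition xi -> measurable_partition (iterated_join T xi n).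
Proof.
move=> mxi w.
have -> : iterated_join T xi n @^-1` [set w] =
    \big[setI/setT]_(i < n) (iter i T @^-1` (xi @^-1` [set w i])).
  rewrite -bigcap_seq; apply/seteqP; split=> x /=.
    by move=> <- i _ /=; rewrite ffunE.
  by move=> xw; apply/ffunP => i; rewrite ffunE; apply: xw; exact: mem_index_enum.
apply: bigsetI_measurable => i _.
by have [] := invariant_iter i mT muT (mxi (w i)).
Qed.

Variable eta : nat -> X -> nat.
Hypotheses (eta_lt : forall m x, (eta m x < 2 ^ m)%N)
  (eta_ref : refining eta)
  (eta_T : forall m x y, eta m.+1 x = eta m.+1 y -> eta m (T x) = eta m (T y)).

Lemma eta_iter m i n x y : (m + i <= n)%N ->
  eta n x = eta n y -> eta m (iter i T x) = eta m (iter i T y).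
Proof.
move=> min /(refining_le eta_ref min); elim: i m {min} => [|i IHi] m.
  by rewrite addn0.
by rewrite addnS -addSn => /IHi /eta_T.
Qed.

(* An itinerary of [xi] is predicted from the label [a] of level [m + n], each
   symbol being guessed correctly with weight 1/2. *)
Lemma iterated_join_entropy_le k (xi xi' : X -> 'I_k.+1) m E n :
  measurable_partition xi ->
  (forall x y, eta m x = eta m y -> xi' x = xi' y) -> measurable E ->
  (forall x, ~ E x -> xi x = xi' x) ->
  partition_entropy mu (iterated_join T xi n) <=
    (m + n + n)%:R * ln 2 + n%:R * (ln k.+1%:R * fine (mu E)).
Proof.
move=> mxi etaxi' mE xiE.
have ln2 : 0 <= ln 2 :> R by rewrite ln_ge0// ler1n.
have lnk : 0 <= ln k.+1%:R :> R by rewrite ln_ge0// ler1n.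
pose N := (m + n)%N.
(* The weight of the symbol [j] when [l] is guessed: one half if the guess is right, one half
   divided by the number of symbols otherwise, for a total of at most 1. *)
pose r (j l : 'I_k.+1) : R := if j == l then 2^-1 else (2 * k.+1%:R)^-1.
have r0 j l : 0 < r j l by rewrite /r; case: ifP; rewrite invr_gt0 ?mulr_gt0.
have r1 l : \sum_j r j l <= 1.
  rewrite (bigD1 l)//= {1}/r eqxx.
  rewrite (le_trans (y := 2^-1 + \sum_(j < k.+1) (2 * k.+1%:R)^-1))//.
    rewrite lerD2l [leRHS](bigD1 l)//= ler_wpDl ?invr_ge0 ?mulr_ge0//.
    by apply: ler_sum => j /negbTE jl; rewrite /r jl.
  rewrite sumr_const card_ord -[_ *+ k.+1]mulr_natr [X in _ + X](_ : _ = 2^-1); first lra.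
  by rewrite invfM -mulrA mulVf ?mulr1.
(* The guess at time [i] for points of label [a]: since [m + i <= N], the label determines the value
   of [xi'] there. Labels carried by no point get the default [ord0]. *)
pose s a i := xget ord0 [set j | exists x, eta N x = a /\ xi' (iter i T x) = j].
have sE x (i : 'I_n) : s (eta N x) i = xi' (iter i T x).
  rewrite /s; case: xgetP => [_ -> [y [xy <-]]|/(_ (xi' (iter i T x)))[]]; last first.
    by exists x.
  by apply/etaxi'/eta_iter/xy; rewrite leq_add2l ltnW.
(* The mixture, with equal weights over the [2 ^ N] labels, of the product weights around the
   guessed words. *)
pose q (w : {ffun 'I_n -> 'I_k.+1}) : R :=
  \sum_(a < 2 ^ N) (2 ^+ N)^-1 * \prod_i r (w i) (s a i).
have t0 (w : {ffun 'I_n -> 'I_k.+1}) a : 0 < (2 ^+ N)^-1 * \prod_i r (w i) (s a i).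
  by rewrite mulr_gt0 ?invr_gt0 ?exprn_gt0// prodr_gt0.
have q0 w : 0 < q w.
  have lt0N : (0 < 2 ^ N)%N by rewrite expn_gt0.
  rewrite /q (bigD1 (Ordinal lt0N))//= ltr_pwDl ?t0// sumr_ge0// => a _.
  by rewrite ltW// t0.
have q1 : \sum_w q w <= 1.
  rewrite /q exchange_big/= (le_trans (y := \sum_(a < 2 ^ N) (2 ^+ N)^-1))//; last first.
    by rewrite sumr_const card_ord -[_ *+ _]mulr_natr natrX mulVf// expf_neq0.
  apply: ler_sum => a _; rewrite -mulr_sumr ger_pMr ?invr_gt0 ?exprn_gt0//.
  (* The sum over words of a product of weights factors into sums over single symbols, each at most
     1. *)
  rewrite -(bigA_distr_bigA (fun (i : 'I_n) (j : 'I_k.+1) => r j (s a i))).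
  apply: numdomain.Num.Theory.prodr_ile1 => i _.
  by rewrite r1 andbT sumr_ge0// => j _; exact: ltW.
have mit := iterated_join_measurable (n := n) mxi.
(* A wrong guess costs an extra [ln k.+1], and can happen only on [E]. *)
have lnr z : - ln (r (xi z) (xi' z)) <= ln 2 + ln k.+1%:R * \1_E z.
  rewrite /r; case: eqP => [_|xiz].
    by rewrite lnV ?posrE// opprK lerDl mulr_ge0.
  rewrite lnV ?posrE ?mulr_gt0// opprK lnM ?posrE// indicE mem_set ?mulr1//.
  by apply: contrapT => /xiE.
have lnq x : - ln (q (iterated_join T xi n x)) <=
    N%:R * ln 2 + n%:R * ln 2
      + \sum_(i < n) ln k.+1%:R * \1_(iter i T @^-1` E) x.
  (* Of the mixture only the term of the true label of [x] is kept: choosing the label costs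
     [N * ln 2], and each of the [n] guesses costs [ln 2] plus the penalty for errors. *)
  rewrite (le_trans (y := - ln ((2 ^+ N)^-1 *
      \prod_(i < n) r (xi (iter i T x)) (xi' (iter i T x)))))//.
    rewrite lerN2 ler_ln ?posrE ?mulr_gt0 ?invr_gt0 ?exprn_gt0 ?prodr_gt0//.
    rewrite /q (bigD1 (Ordinal (eta_lt N x)))//= -[leLHS]addr0 lerD//.
      rewrite ler_pM2l ?invr_gt0 ?exprn_gt0// le_eqVlt; apply/orP; left.
      by apply/eqP/eq_bigr => i _; rewrite ffunE sE.
    by rewrite sumr_ge0// => a _; rewrite ltW.
  rewrite lnM ?posrE ?invr_gt0 ?exprn_gt0 ?prodr_gt0// ln_prod//.
  rewrite lnV ?posrE ?exprn_gt0// lnXn// opprD opprK -[ln 2 *+ N]mulr_natl -addrA.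
  rewrite lerD2l -sumrN.
  have -> : n%:R * ln 2 = \sum_(i < n) ln 2 :> R by rewrite sumr_const card_ord mulr_natl.
  by rewrite -big_split/=; apply: ler_sum => i _; exact: lnr.
rewrite -lee_fin (le_trans (partition_entropy_le mu mit q0 q1))//.
pose g x : R := \sum_(i < n) ln k.+1%:R * \1_(iter i T @^-1` E) x.
have miE (i : 'I_n) : measurable (iter i T @^-1` E).
  by have [] := invariant_iter i mT muT mE.
have mg : measurable_fun setT g by exact: measurable_sum_indic.
have C0 : 0 <= N%:R * ln 2 + n%:R * ln 2 :> R by rewrite addr_ge0 ?mulr_ge0.
apply: (@le_trans _ _ (\int[mu]_x ((N%:R * ln 2 + n%:R * ln 2)%:E + (g x)%:E))%E).
  apply: ge0_le_integral => //.
  - move=> x _; rewrite lee_fin oppr_ge0 ln_le0// (le_trans _ q1)//.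
    rewrite (bigD1 (iterated_join T xi n x))//= lerDl sumr_ge0// => w _.
    exact: ltW.
  - apply/measurable_EFinP.
    under eq_fun do rewrite (label_sum_indic _ (fun w => - ln (q w))).
    exact: measurable_sum_indic.
  - by apply: emeasurable_funD => //; exact/measurable_EFinP.
  - by move=> x _; rewrite -EFinD lee_fin.
rewrite ge0_integralD//; last 2 first.
- by move=> x _; rewrite lee_fin sumr_ge0// => i _; rewrite mulr_ge0.
- exact/measurable_EFinP.
rewrite integral_cst//= probability_setT mule1 integral_sum_indic//.
rewrite -EFinD lee_fin natrD mulrDl lerD2l.
(* By invariance each of the [n] error sets has the measure of [E]. *)
under eq_bigr do rewrite (invariant_iter _ mT muT mE).2.
by rewrite sumr_const card_ord mulr_natl.
Qed.

(** [E] is taken so small that errors cost at most 1 per symbol; the remaining cost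
    [(m + 2 n) * ln 2] is at most [3 n * ln 2] once [n] exceeds [m]. *)
Lemma ks_entropy_le : (forall A, measurable A -> approximable mu eta A) ->
  (ks_entropy mu T <= (3 * ln 2 + 1)%:E)%E.
Proof.
move=> apA; apply: ge_ereal_sup => _ [k [xi [mxi ->]]]; rewrite lee_fin.
have ln2 : 0 <= ln 2 :> R by rewrite ln_ge0// ler1n.
have [x0 _] : [set: X] !=set0.
  apply/set0P/eqP => X0; have := probability_setT mu.
  by rewrite X0 measure0 => /esym/eqP; rewrite onee_eq0.
case: k xi mxi => [xi|k xi mxi]; first by case: (xi x0).
have lnk : 0 <= ln k.+1%:R :> R by rewrite ln_ge0// ler1n.
have e0 : 0 < (ln k.+1%:R + 1)^-1 :> R by rewrite invr_gt0 ltr_wpDl.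
have [m [xi' [E [exi' mE muE xiE]]]] :=
  approximable_labelling ord0 eta_ref (fun j => apA _ (mxi j)) e0.
have muE1 : ln k.+1%:R * fine (mu E) <= 1.
  have muEr : fine (mu E) <= (ln k.+1%:R + 1)^-1 by rewrite -lee_fin fineK// fin_num_measure.
  rewrite (le_trans (ler_wpM2l lnk muEr))// ler_pdivrMr ?ltr_wpDl//.
  by rewrite mul1r lerDl.
rewrite /partition_entropy_rate.
(* For a divergent sequence [limn] is the default value 0, which also satisfies the bound. *)
set u := (u in limn u); have [cu|/dvgP ->] := pselect (cvgn u); last first.
  by rewrite addr_ge0 ?mulr_ge0.
apply: limr_le => //; exists m.+1 => // n /= mn.
have n0 : 0 < n%:R :> R by rewrite ltr0n (leq_trans _ mn).
rewrite /u ler_pdivrMr// (le_trans (iterated_join_entropy_le n mxi exi' mE xiE))//.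
rewrite mulrDl mul1r addrC [leRHS]addrC lerD//.
  by rewrite ler_piMr// ltW.
rewrite mulrAC ler_wpM2r// -natrM ler_nat; lia.
Qed.

End entropy_bound.

(** The partition into a single cell has entropy rate 0. *)
Lemma ks_entropy_ge0 d (X : measurableType d) (R : realType)
  (mu : probability X R) (T : X -> X) : (0 <= ks_entropy mu T)%E.
Proof.
apply: ereal_sup_ubound; exists 1%N, (fun=> ord0); split.
  by move=> j; rewrite (_ : _ @^-1` _ = setT)//; apply/seteqP; split=> // x _; rewrite /= [RHS]ord1.
congr EFin; rewrite /partition_entropy_rate.
rewrite (_ : (fun n => _) = fun=> 0) ?lim_cst//; apply/funext => n.
rewrite /partition_entropy big1 ?oppr0 ?mul0r// => w _ /=.
rewrite (_ : _ @^-1` _ = setT) ?probability_setT ?ln1 ?mulr0//.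
by apply/seteqP; split=> // x _; apply/ffunP => i; rewrite ord1 [RHS]ord1.
Qed.

(** * Binary expansions on the torus *)

Section torus_projection.
Variable R : realType.
Implicit Types (a b : R) (x y : torus R).

Definition torus_pi a : torus R := \pi_(torus R)%qT a.

Lemma torus_piK x : torus_pi (repr x) = x. Proof. exact: reprK. Qed.

Lemma torus_piD a b : torus_pi (a + b) = torus_pi a + torus_pi b.
Proof. by rewrite /torus_pi !piE. Qed.

Lemma torus_piN a : torus_pi (- a) = - torus_pi a.
Proof. by rewrite /torus_pi !piE. Qed.

Lemma torus_piB a b : torus_pi (a - b) = torus_pi a - torus_pi b.
Proof. by rewrite torus_piD torus_piN. Qed.

Lemma torus_pi0 : torus_pi 0 = 0.
Proof. by apply: (addrI (torus_pi 0)); rewrite -torus_piD !addr0. Qed.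

Lemma torus_piMn a n : torus_pi (a *+ n) = torus_pi a *+ n.
Proof. by elim: n => [|n IHn]; rewrite ?mulr0n ?torus_pi0// !mulrS torus_piD IHn. Qed.

Lemma torus_pi_eqP a b : torus_pi a = torus_pi b <-> exists z : int, a = b + z%:~R.
Proof.
have intE : (a - b \is a Num.int) = (torus_pi a == torus_pi b).
  exact: (Quotient.idealrBE (Num.int_num_subdef : {pred R})).
split=> [/eqP|[z abz]].
  by rewrite -intE => /intrP[z abz]; exists z; rewrite -abz addrC subrK.
by apply/eqP; rewrite -intE abz addrAC subrr add0r intr_int.
Qed.

Lemma open_torusE (U : set (torus R)) : open U = open (torus_pi @^-1` U).
Proof. by []. Qed.

Lemma open_measurable_torus (U : set (torus R)) : open U -> measurable U.
Proof. exact: sub_sigma_algebra. Qed.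

Lemma measurable_fun_torus (f : torus R -> R) :
  continuous (f \o torus_pi) -> measurable_fun setT f.
Proof.
move=> cf; apply: (measurability _ (RGenOpens.measurableE R)) => //.
move=> _ [_ [a [b ->] <-]]; rewrite setTI; apply: open_measurable_torus.
by rewrite open_torusE -comp_preimage; move/continuousP : cf; apply; exact: interval_open.
Qed.

Lemma measurable_doubling : measurable_fun setT (@doubling R).
Proof.
apply: (@measurability _ _ _ _ setT _ (@open (torus R))) => //.
move=> _ [U oU <-]; rewrite setTI; apply: open_measurable_torus.
rewrite open_torusE (_ : _ @^-1` _ = (fun a => a *+ 2) @^-1` (torus_pi @^-1` U)).
  have : continuous (fun a : R => a *+ 2) by move=> a; apply: cvgMn; exact: cvg_id.
  by move/continuousP; apply; rewrite -open_torusE.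
by apply/seteqP; split=> a; rewrite /preimage/= torus_piMn.
Qed.

(* [repr] is an arbitrary representative; this one lies in [0, 1). *)
Definition torus_lift x : R := repr x - (Num.floor (repr x))%:~R.

Lemma torus_lift_ge0 x : 0 <= torus_lift x. Proof. by rewrite subr_ge0 floor_le. Qed.

Lemma torus_lift_lt1 x : torus_lift x < 1.
Proof. by rewrite ltrBlDl -[1]/(1%:~R) -intrD floorD1_gt. Qed.

Lemma torus_liftK x : torus_pi (torus_lift x) = x.
Proof.
rewrite -[RHS]torus_piK; apply/torus_pi_eqP; exists (- Num.floor (repr x)).
by rewrite intrN.
Qed.

Lemma torus_lift_unique a x : 0 <= a < 1 -> torus_pi a = x -> torus_lift x = a.
Proof.
move=> /andP[a0 a1]; rewrite -[x in _ = x]torus_liftK => /torus_pi_eqP[z az].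
have x0 := torus_lift_ge0 x; have x1 := torus_lift_lt1 x.
have : (-1)%:~R < z%:~R :> R by lra.
have : z%:~R < 1%:~R :> R by lra.
rewrite !ltr_int => z1 zN1; have z0 : z = 0 by lia.
by rewrite az z0 addr0.
Qed.

Lemma torus_lift_doubling x : exists b : bool, torus_lift (doubling x) = torus_lift x * 2 - b%:R.
Proof.
have x0 := torus_lift_ge0 x; have x1 := torus_lift_lt1 x.
exists (2^-1 <= torus_lift x)%R; apply: torus_lift_unique.
  by have [|] := leP (2^-1 : R) (torus_lift x) => /=; lra.
rewrite /doubling -[in RHS](torus_liftK x) -torus_piMn; apply/torus_pi_eqP.
exists (- (2^-1 <= torus_lift x)%R%:R); rewrite mulr_natr intrN.
by case: leP.
Qed.

Lemma open_torus_lift_oo r : 0 <= r <= 1 -> open [set x | 0 < torus_lift x < r].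
Proof.
move=> r01; rewrite open_torusE.
rewrite (_ : _ @^-1` _ = \bigcup_(z : int) `]z%:~R, z%:~R + r[%classic).
  by apply: bigcup_open => z _; exact: interval_open.
apply/seteqP; split=> a /=.
  move=> ar.
  have /torus_pi_eqP[z az] : torus_pi a = torus_pi (torus_lift (torus_pi a)).
    by rewrite torus_liftK.
  by exists z => //=; rewrite in_itv/= az; lra.
move=> [z _ /=]; rewrite in_itv/= => az.
rewrite (@torus_lift_unique (a - z%:~R)); [lra|lra|].
by apply/torus_pi_eqP; exists (- z); rewrite intrN.
Qed.

Lemma measurable_torus_lift : measurable_fun setT torus_lift.
Proof.
apply: (measurability _ (RGenInftyO.measurableE R)) => //.
move=> _ [_ [r ->] <-]; rewrite setTI.
have [r0|r0] := leP r 0.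
  rewrite (_ : _ @^-1` _ = set0)//; apply/seteqP; split=> // x /=.
  by rewrite in_itv/= => /lt_le_trans/(_ r0); rewrite ltNge torus_lift_ge0.
have [r1|r1] := leP 1 r.
  rewrite (_ : _ @^-1` _ = setT)//; apply/seteqP; split=> // x _ /=.
  by rewrite in_itv/= (lt_le_trans (torus_lift_lt1 x)).
(* The lift jumps at 0, so the sublevel set is an open arc together with the point where the lift
   vanishes, itself the complement of an open arc. *)
rewrite (_ : _ @^-1` _ = [set x | 0 < torus_lift x < r] `|` ~` [set x | 0 < torus_lift x < 1]).
  apply: measurableU; [|apply: measurableC]; apply: open_measurable_torus;
    apply: open_torus_lift_oo.
  - by rewrite (ltW r0) (ltW r1).
  - by rewrite lexx ler01.
apply/seteqP; split=> x /=; rewrite in_itv/=;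
  have x0 := torus_lift_ge0 x; have x1 := torus_lift_lt1 x.
  by move=> xr; case: (ltP 0 (torus_lift x)) => xp; [left|right] => //=; rewrite ?xp ?ltNge ?xp.
by move=> [/andP[]//|/negP]; rewrite x1 andbT -leNgt => x00; exact: le_lt_trans r0.
Qed.

(** The first [m] binary digits of [x], read as an integer. *)
Definition dyadic_label m x : nat := Num.truncn (2 ^+ m * torus_lift x).

Lemma dyadic_label_itv m x :
  (dyadic_label m x)%:R <= 2 ^+ m * torus_lift x < (dyadic_label m x).+1%:R.
Proof. by rewrite truncn_itv// mulr_ge0// torus_lift_ge0. Qed.

Lemma dyadic_label_lt m x : (dyadic_label m x < 2 ^ m)%N.
Proof.
rewrite /dyadic_label truncn_lt_nat ?mulr_ge0 ?torus_lift_ge0// natrX.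
by rewrite gtr_pMr ?torus_lift_lt1// exprn_gt0.
Qed.

Lemma dyadic_label_half m x : dyadic_label m x = (dyadic_label m.+1 x)./2.
Proof.
apply: truncn_def; have := dyadic_label_itv m.+1 x; rewrite exprS.
set n := dyadic_label _ _; rewrite -{1 2}[n]odd_double_half.
rewrite -mulrA -addn1 -addnS !natrD -muln2 !natrM -[_.+1]addn1 natrD.
by case: (odd n) => /=; lra.
Qed.

Lemma refining_dyadic : refining dyadic_label.
Proof. by move=> m x y xy; rewrite dyadic_label_half xy -dyadic_label_half. Qed.

(** Doubling erases the leading digit: the label of level [m + 1] is the level [m] label of the
    doubled point plus [b * 2 ^ m]. As the latter label is below [2 ^ m], it is recovered as a
    remainder. *)
Lemma dyadic_label_doubling m x y : dyadic_label m.+1 x = dyadic_label m.+1 y ->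
  dyadic_label m (doubling x) = dyadic_label m (doubling y).
Proof.
have shift z : exists b : bool,
    dyadic_label m.+1 z = (dyadic_label m (doubling z) + b * 2 ^ m)%N.
  have [b zb] := torus_lift_doubling z; exists b; apply: truncn_def.
  have := dyadic_label_itv m (doubling z); rewrite zb exprSr.
  rewrite -[(_ + _).+1%:R]natr1 -[(dyadic_label m (doubling z)).+1%:R]natr1.
  by rewrite natrD natrM natrX; case: b {zb} => /=; lra.
have [b ->] := shift x; have [b' ->] := shift y.
have := dyadic_label_lt m (doubling x); have := dyadic_label_lt m (doubling y).
by case: b; case: b'; lia.
Qed.

Lemma measurable_saturated_dyadic m D :
  saturated dyadic_label m D -> measurable D.
Proof.
move=> satD.
rewrite (_ : D = \bigcup_(a in dyadic_label m @` D)
    (torus_lift @^-1` `[a%:R / 2 ^+ m, a.+1%:R / 2 ^+ m[%classic)).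
  apply: bigcup_measurable => a _; rewrite -[_ @^-1` _]setTI.
  exact: measurable_torus_lift.
have labE (a : nat) x : (dyadic_label m x == a) =
    (torus_lift x \in `[a%:R / 2 ^+ m, a.+1%:R / 2 ^+ m[).
  rewrite truncn_eq ?mulr_ge0 ?torus_lift_ge0// in_itv/=.
  by rewrite ler_pdivrMr ?exprn_gt0// ltr_pdivlMr ?exprn_gt0// mulrC.
apply/seteqP; split=> x.
  by move=> Dx; exists (dyadic_label m x); [exists x|rewrite /= -labE].
by move=> [_ [y Dy <-]] /=; rewrite -labE => /eqP/esym; move/satD; exact.
Qed.

Lemma approximable_open (mu : probability (torus R) R) U :
  open U -> approximable mu dyadic_label U.
Proof.
(* [D m] is the union of the dyadic cells of level [m] contained in [U]. These sets exhaust [U]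
   because cells have length [2 ^ -m], and each is approximated by itself without error. *)
move=> oU; pose D m : set (torus R) :=
  [set x | forall y, dyadic_label m y = dyadic_label m x -> U y].
have satD m : saturated dyadic_label m (D m).
  by move=> x y xy Dx z; rewrite -xy; exact: Dx.
have -> : U = \bigcup_m D m.
  apply/seteqP; split=> [x Ux|x [m _ Dx]]; last exact: Dx.
  move: oU; rewrite open_torusE => /(_ (torus_lift x)).
  rewrite /preimage/= torus_liftK => /(_ Ux) /nbhs_ballP[e /= e0 eU].
  have [m me] : exists m, (2 ^+ m)^-1 < e.
    exists (Num.truncn e^-1).+1; rewrite invf_plt ?posrE ?exprn_gt0//.
    rewrite (lt_trans (truncnS_gt _))// -natrX ltr_nat.
    exact: ltn_expl.
  exists m => // y yx; rewrite -(torus_liftK y); apply: eU.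
  rewrite /ball/=; have := dyadic_label_itv m x; have := dyadic_label_itv m y.
  rewrite yx => ly lx; rewrite (lt_trans _ me)//.
  rewrite -(ltr_pM2l (_ : 0 < 2 ^+ m)) ?exprn_gt0// divff ?expf_neq0//.
  rewrite -[X in X * _]ger0_norm ?exprn_ge0// -normrM mulrBr ltr_norml.
  by move: lx ly; rewrite -[_.+1]addn1 natrD; lra.
apply: approximable_bigcup; first exact: refining_dyadic.
move=> m; split; first exact: measurable_saturated_dyadic.
move=> e e0; exists m, (D m), set0; split=> //.
by rewrite measure0 lte_fin.
Qed.

Lemma approximable_measurable_torus (mu : probability (torus R) R) A :
  measurable A -> approximable mu dyadic_label A.
Proof.
apply: smallest_sub; first exact/approximable_sigma_algebra/refining_dyadic.
exact: approximable_open.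
Qed.

Lemma ks_entropy_doubling_le (mu : probability (torus R) R) :
  invariant_measure mu (@doubling R) ->
  (ks_entropy mu (@doubling R) <= (3 * ln 2 + 1)%:E)%E.
Proof.
move=> muT; apply: (ks_entropy_le measurable_doubling muT dyadic_label_lt refining_dyadic).
  exact: dyadic_label_doubling.
exact: approximable_measurable_torus.
Qed.

End torus_projection.

(** * The potential and its truncations *)

Lemma sin_lipschitz (R : realType) (a b : R) : `|sin a - sin b| <= `|a - b|.
Proof.
wlog ab : a b / a <= b.
  by move=> H; have [/H//|/ltW/H] := leP a b; rewrite distrC [leRHS]distrC.
have [] := @MVT_segment R sin cos a b ab.
  by apply: continuous_subspaceT => x; exact: continuous_sin.
move=> x _ E; rewrite distrC [leRHS]distrC E normrM ler_piMl//.
exact: cos_max.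
Qed.

Lemma abs_sin_pi_periodic (R : realType) (a : R) (z : int) :
  `|sin (pi * (a + z%:~R))| = `|sin (pi * a)|.
Proof.
have natP (b : R) n : `|sin (pi * (b + n%:R))| = `|sin (pi * b)|.
  by rewrite mulrDr mulr_natr (alternatingn (@sinDpi R)) normrM normrX normrN1 expr1n mul1r.
case: z => n; first exact: natP.
by rewrite -(natP (a + _) n.+1) NegzE intrN -pmulrn subrK.
Qed.

Section potential.
Variable R : realType.
Implicit Types (c x y : torus R) (a b e : R).

(** Half the Euclidean distance between the points of the unit circle with angles [2 pi x] and
    [2 pi c]. *)
Definition chord c x : R := `|sin (pi * repr (x - c))|.

Lemma chord_le1 c x : chord c x <= 1. Proof. exact: sin_max. Qed.

Lemma chord_torus_pi c a : chord c (torus_pi a) = `|sin (pi * (a - repr c))|.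
Proof.
have /torus_pi_eqP[z E] : torus_pi (repr (torus_pi a - c)) = torus_pi (a - repr c).
  by rewrite torus_piB !torus_piK.
by rewrite /chord E abs_sin_pi_periodic.
Qed.

Lemma chord_lipschitz c a b : chord c (torus_pi a) <= chord c (torus_pi b) + pi * `|a - b|.
Proof.
rewrite !chord_torus_pi -lerBlDl (le_trans (ler_norm _))//.
rewrite (le_trans (ler_dist_dist _ _))// (le_trans (sin_lipschitz _ _))//.
by rewrite -mulrBr normrM ger0_norm ?pi_ge0// opprB addrA addrNK.
Qed.

Lemma measurable_chord c : measurable_fun setT (chord c).
Proof.
apply: measurable_fun_torus.
rewrite (_ : _ \o _ = fun a => `|sin (pi * (a - repr c))|); last first.
  by apply/funext => a /=; rewrite chord_torus_pi.
move=> a; apply: cvg_norm; apply: continuous_comp; last exact: continuous_sin.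
by apply: cvgM; [exact: cvg_cst|apply: cvgB; [exact: cvg_id|exact: cvg_cst]].
Qed.

Lemma psiE c x :
  psi c x = if chord c x <= 0 then -oo%E else (2 * ln (chord c x))%:E.
Proof.
rewrite /psi -/(chord c x) /=; case: ifP => // _.
by rewrite mulrNy gtr0_sg ?mul1e.
Qed.

Lemma psi_le0 c x : (psi c x <= 0)%E.
Proof.
rewrite psiE; case: ifP => [_|_]; first exact: leNye.
by rewrite lee_fin pmulr_rle0// ln_le0// chord_le1.
Qed.

Lemma measurable_psi c : measurable_fun setT (psi c).
Proof.
rewrite (_ : psi c = fun x => if chord c x <= 0 then -oo%E else (2 * ln (chord c x))%:E).
  apply: measurable_fun_ifT => //.
    by apply: measurable_fun_ler => //; exact: measurable_chord.
  apply/measurable_EFinP/measurable_funM => //.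
  by apply: measurableT_comp => //; exact: measurable_chord.
by apply/funext => x; rewrite psiE.
Qed.

Lemma integral_psiN (mu : probability (torus R) R) c :
  (\int[mu]_x psi c x = - \int[mu]_x (- psi c x))%E.
Proof.
rewrite -integral_ge0N; last by move=> x _; rewrite oppe_ge0 psi_le0.
by under [RHS]eq_integral do rewrite oppeK.
Qed.

(** The potential cut off from below at [2 ln e], with the sign changed so that it is nonnegative
    when [e <= 1]. *)
Definition truncated_psi e c x : R := - (2 * ln (Num.max (chord c x) e)).

Lemma truncated_psi_ge0 e c x : 0 < e <= 1 -> 0 <= truncated_psi e c x.
Proof.
move=> /andP[e0 e1]; rewrite oppr_ge0 pmulr_rle0// ln_le0//.
by rewrite ge_max chord_le1.
Qed.

Lemma psi_le_truncated e c x : 0 < e -> (psi c x <= (- truncated_psi e c x)%:E)%E.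
Proof.
move=> e0; rewrite psiE; case: (leP (chord c x) 0) => [_|cx]; first exact: leNye.
rewrite lee_fin opprK ler_pM2l// ler_ln ?posrE// ?lt_max ?cx//.
by rewrite le_max lexx.
Qed.

Lemma measurable_truncated_psi e c : measurable_fun setT (truncated_psi e c).
Proof.
apply: measurable_funN; apply: measurable_funM => //.
apply: measurableT_comp => //; apply: measurable_maxr => //.
exact: measurable_chord.
Qed.

(** The chord is [pi]-Lipschitz and [2 ln] is [2 / e]-Lipschitz on the half-line above [e]. Real
    representatives are used so that distances are those of the line. *)
Lemma truncated_psi_lipschitz e c a b : 0 < e ->
  truncated_psi e c (torus_pi a) - 2 * pi / e * `|a - b| <= truncated_psi e c (torus_pi b).
Proof.
move=> e0; rewrite /truncated_psi.
set u := Num.max _ _; set v := Num.max _ _.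
have u0 : 0 < u by rewrite lt_max e0 orbT.
have v0 : 0 < v by rewrite lt_max e0 orbT.
have vu : v <= u + pi * `|a - b|.
  rewrite ge_max; apply/andP; split.
    by rewrite (le_trans (chord_lipschitz c b a))// distrC lerD2r le_max lexx.
  by rewrite -[leLHS]addr0 lerD ?le_max ?lexx ?orbT// mulr_ge0// pi_ge0.
have eu : e <= u by rewrite le_max lexx orbT.
have : ln (v / u) <= pi * `|a - b| / e.
  have vu0 : 0 < v / u by rewrite divr_gt0.
  have := @le_ln1Dx R (v / u - 1); rewrite ltrBrDr addNr vu0 [1 + _]addrC subrK.
  move=> /(_ isT)/le_trans; apply; rewrite lerBlDr ler_pdivrMr// mulrDl mul1r.
  rewrite (le_trans vu)// addrC lerD2r mulrAC ler_pdivlMr//.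
  by rewrite ler_wpM2l// mulr_ge0// pi_ge0.
by rewrite ln_div ?posrE// => H; lra.
Qed.

Import HBSimple HBNNSimple.

(** The integral of [- psi c] is a supremum over simple functions below it. A simple function is
    bounded, so a truncation at a large enough height still dominates it. *)
Lemma truncated_integral_gt (mu : probability (torus R) R) c (M : R) :
  (\int[mu]_x psi c x < (- M)%:E)%E ->
  exists e, 0 < e <= 1 /\ (M%:E < \int[mu]_x (truncated_psi e c x)%:E)%E.
Proof.
rewrite integral_psiN EFinN lteN2 ge0_integralTE; last by move=> x; rewrite oppe_ge0 psi_le0.
move=> /ereal_sup_gt[_ [h hpsi <-] Mh].
have [K [_ Kh]] := simple_bounded h.
pose B := Num.max (K + 1) 0.
have hB x : h x <= B.
  rewrite (le_trans (ler_norm _))//.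
  by apply: Kh => //; rewrite lt_max ltrDl ltr01.
(* With this [e] the truncation height [-2 ln e] is exactly [B]; [B >= 0] gives [e <= 1]. *)
exists (expR (- (B / 2))); split.
  by rewrite expR_gt0 -expR0 ler_expR oppr_le0 divr_ge0// le_max lexx orbT.
apply: (lt_le_trans Mh); rewrite -integralT_nnsfun; apply: ge0_le_integral => //.
- by move=> x _; rewrite lee_fin.
- exact/measurable_EFinP.
- by apply/measurable_EFinP; exact: measurable_truncated_psi.
move=> x _; rewrite lee_fin /truncated_psi.
have [cx|cx] := leP (chord c x) (expR (- (B / 2))).
  by rewrite expRK mulrN opprK mulrC divfK.
have := hpsi x; rewrite psiE [chord c x <= 0]leNgt (lt_trans (expR_gt0 _) cx)/=.
by rewrite lee_fin.
Qed.

(** Otherwise the Birkhoff sum is at most [N * M] everywhere, and integrating it against an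
    invariant measure contradicts the lower bound on the integral. *)
Lemma exists_large_birkhoff_sum (mu : probability (torus R) R) e c (M : R) N :
  inv_measures mu -> 0 < e <= 1 ->
  (M%:E < \int[mu]_x (truncated_psi e c x)%:E)%E ->
  exists x, N%:R * M <= \sum_(i < N) truncated_psi e c (iter i (@doubling R) x).
Proof.
have [->|N0] := posnP N; first by exists 0; rewrite mul0r big_ord0.
move=> muT e01 Mint; apply: contrapT => noX.
have lt_sum x : \sum_(i < N) truncated_psi e c (iter i (@doubling R) x) <= N%:R * M.
  by apply/ltW; rewrite ltNge; apply/negP => H; apply: noX; exists x.
have F0 x := truncated_psi_ge0 c x e01.
have muI i A : measurable A -> _ := invariant_iter i (@measurable_doubling R) muT.
have mi i : measurable_fun setT (iter i (@doubling R)).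
  by move=> _ A mA; rewrite setTI; have [] := muI i A mA.
have mF := measurable_truncated_psi e c.
have mFi i : measurable_fun setT (truncated_psi e c \o iter i (@doubling R)).
  exact: measurableT_comp.
have intF i : (\int[mu]_x (truncated_psi e c (iter i (@doubling R) x))%:E
    = \int[mu]_x (truncated_psi e c x)%:E)%E.
  rewrite -(@ge0_integral_pushforward _ _ _ _ _ _ (mi i) mu setT
      (fun x => (truncated_psi e c x)%:E)) ?preimage_setT//.
  - apply: eq_measure_integral => A mA _.
    by have [] := muI i A mA.
  - exact/measurable_EFinP.
  - by move=> x _; rewrite lee_fin.
have : (\int[mu]_x (\sum_(i < N) (truncated_psi e c (iter i (@doubling R) x))%:E)
    <= (N%:R * M)%:E)%E.
  apply: (@le_trans _ _ (\int[mu]_x (N%:R * M)%:E)%E).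
    apply: ge0_le_integral => //.
    - by move=> x _; apply: sume_ge0 => i _; rewrite lee_fin.
    - by apply: emeasurable_sum => i; apply/measurable_EFinP; exact: mFi.
    - by move=> x _; rewrite sumEFin lee_fin.
  by rewrite integral_cst//= probability_setT mule1.
rewrite ge0_integral_sum//.
- under eq_bigr do rewrite intF.
  rewrite sumr_const card_ord -[leLHS](mule_natl _ N) EFinM lee_pmul2l ?lte_fin ?ltr0n//.
  by rewrite leNgt Mint.
- by move=> i; apply/measurable_EFinP; exact: mFi.
- by move=> i x _; rewrite lee_fin.
Qed.

End potential.

(** * Periodic orbits *)

Section orbit_measure.
Context d (X : measurableType d) (R : realType) (T : X -> X) (n : nat) (y : X).
Local Open Scope ereal_scope.

(* The average is over the n.+1 points y, T y, ..., T^n y. *)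
Definition orbit_measure : set X -> \bar R :=
  mscale (n.+1%:R^-1)%:nng%R (msum (fun i => \d_(iter i T y)) n.+1).

HB.instance Definition _ := Measure.on orbit_measure.

Lemma orbit_measureE A :
  orbit_measure A = n.+1%:R^-1%:E * \sum_(i < n.+1) \d_(iter i T y) A.
Proof. by []. Qed.

Let orbit_measure_setT : orbit_measure setT = 1.
Proof.
rewrite orbit_measureE; under eq_bigr do rewrite diracT.
by rewrite sumEFin sumr_const card_ord -EFinM mulVf.
Qed.

HB.instance Definition _ :=
  Measure_isProbability.Build _ _ _ orbit_measure orbit_measure_setT.

(** Taking preimages shifts the sum of point masses by one step, and periodicity identifies the new
    last term with the old first one. *)
Lemma orbit_measure_invariant :
  iter n.+1 T y = y -> invariant_measure (orbit_measure : probability X R) T.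
Proof.
move=> Ty A _; rewrite [LHS]orbit_measureE [RHS]orbit_measureE; congr (_ * _).
rewrite big_ord_recr [RHS]big_ord_recl/= addeC; congr (_ + _).
by rewrite !diracE -[in RHS]Ty.
Qed.

Lemma integral_orbit_measure (f : X -> \bar R) : measurable_fun setT f ->
  (forall x, 0 <= f x) ->
  \int[orbit_measure]_x f x = n.+1%:R^-1%:E * \sum_(i < n.+1) f (iter i T y).
Proof.
move=> mf f0; rewrite ge0_integral_mscale//= ge0_integral_measure_sum//.
by congr (_ * _); apply: eq_bigr => i _; rewrite integral_dirac// diracT mul1e.
Qed.

End orbit_measure.

Section periodic_points.
Variable R : realType.
Implicit Types (c x y : torus R) (a : R) (k : int).

Lemma iter_doubling i x : iter i (@doubling R) x = x *+ 2 ^ i.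
Proof.
elim: i => [|i IHi]; first by rewrite expn0 mulr1n.
by rewrite iterS IHi /doubling -mulrnA expnSr.
Qed.

Lemma open_torus_neq c : open [set x | x != c].
Proof.
rewrite (_ : mkset _ = (fun x => x - c) @^-1` [set x | 0 < torus_lift x < 1]).
  rewrite open_torusE (_ : _ @^-1` _ =
      (fun a => a - repr c) @^-1` (@torus_pi R @^-1` [set x | 0 < torus_lift x < 1])).
    have : continuous (fun a : R => a - repr c).
      by move=> a; apply: cvgB; [exact: cvg_id|exact: cvg_cst].
    by move/continuousP; apply; rewrite -open_torusE; apply: open_torus_lift_oo; rewrite ler01 lexx.
  by apply/seteqP; split=> a; rewrite /preimage/= torus_piB torus_piK.
apply/seteqP; split=> x /=; rewrite torus_lift_lt1 andbT lt_def torus_lift_ge0 andbT.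
  by apply: contra_neq => x0; apply/subr0_eq; rewrite -(torus_liftK (x - c)) x0 torus_pi0.
apply: contra_neq => ->; rewrite subrr.
by apply: torus_lift_unique; rewrite ?lexx ?ltr01 ?torus_pi0.
Qed.

(* Fixed points of T^(n+1) are the fractions with this denominator. *)
Definition mersenne n : R := 2 ^+ n.+1 - 1.

Lemma mersenne_gt0 n : 0 < mersenne n.
Proof. by rewrite subr_gt0 exprn_egt1// ltr1n. Qed.

Lemma natr_mersenne n : (2 ^ n.+1 - 1)%N%:R = mersenne n.
Proof. by rewrite natrB ?expn_gt0// natrX. Qed.

Definition periodic_point n k : torus R := torus_pi (k%:~R / mersenne n).

Lemma periodic_pointMn n k : periodic_point n k *+ (2 ^ n.+1 - 1) = 0.
Proof.
rewrite -torus_piMn -torus_pi0; apply/torus_pi_eqP; exists k.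
by rewrite -mulr_natr natr_mersenne divfK ?gt_eqF ?mersenne_gt0// add0r.
Qed.

Lemma iter_doubling_periodic n x :
  x *+ (2 ^ n.+1 - 1) = 0 <-> iter n.+1 (@doubling R) x = x.
Proof.
rewrite iter_doubling mulrnBr ?expn_gt0// mulr1n.
by split=> [/subr0_eq//|->]; rewrite subrr.
Qed.

(** A periodic orbit can meet [c] only if [c] is periodic. If [c] has period [p + 1] and lies on the
    orbits of both candidates, both are killed by [2 ^ (p + 1) - 1], hence so is their difference
    [1 / mersenne n]; for [n > p] this multiple lies strictly between 0 and 1. *)
Lemma periodic_point_avoiding c : exists n0, forall n k, (n0 <= n)%N ->
  exists2 k', (k' == k) || (k' == k + 1) &
    forall i, (i <= n)%N -> iter i (@doubling R) (periodic_point n k') != c.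
Proof.
have [[p cp]|cnp] := pselect (exists p, c *+ (2 ^ p.+1 - 1) = 0).
  exists p.+1 => n k pn; apply: contrapT => noK.
  have orbit_c k' : (k' == k) || (k' == k + 1) ->
      periodic_point n k' *+ (2 ^ p.+1 - 1) = 0.
    move=> kk'; have [i ni ci] : exists2 i, (i <= n)%N
        & iter i (@doubling R) (periodic_point n k') = c.
      apply: contrapT => noi; apply: noK; exists k' => // i ni.
      by apply/eqP => ci; apply: noi; exists i.
    (* Following the orbit from its visit to [c] back to its start shows that the periodic point is
       a multiple of [c]. *)
    have /iter_doubling_periodic <- := periodic_pointMn n k'.
    rewrite -(subnK (leqW ni)) iterD ci iter_doubling.
    by rewrite -mulrnA mulnC mulrnA cp mul0rn.
  have := orbit_c (k + 1); rewrite eqxx orbT => /(_ isT).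
  have := orbit_c k; rewrite eqxx => /(_ isT).
  rewrite -!torus_piMn -torus_pi0 => /torus_pi_eqP[z kz] /torus_pi_eqP[z'].
  have Mn0 := mersenne_gt0 n; have Mp0 := mersenne_gt0 p.
  have Mpn : mersenne p < mersenne n.
    by rewrite ltrD2r ltr_eXn2l ?ltr1n.
  rewrite intrD mulrDl mulrnDl kz !add0r mul1r -mulr_natr natr_mersenne => zz'.
  have zE : (z' - z)%:~R = (mersenne n)^-1 * mersenne p.
    by rewrite intrB -zz' addrC addKr.
  have : 0%:~R < (z' - z)%:~R :> R by rewrite zE mulr_gt0 ?invr_gt0.
  have : (z' - z)%:~R < 1%:~R :> R by rewrite zE mulrC ltr_pdivrMr// mul1r.
  by rewrite !ltr_int; lia.
exists 0%N => n k _; exists k; first by rewrite eqxx.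
move=> i ni; apply/eqP => ci; apply: cnp; exists n.
rewrite -ci iter_doubling -mulrnA mulnC mulrnA.
by rewrite periodic_pointMn mul0rn.
Qed.

(** At time [i] the two points are at most [2 ^ i / mersenne n] apart. These distances sum to 1, so
    the total loss is the Lipschitz constant, whatever [n] is. *)
Lemma periodic_shadowing n k a e c : 0 < e ->
  `|a - k%:~R / mersenne n| <= (mersenne n)^-1 ->
  \sum_(i < n.+1) truncated_psi e c (iter i (@doubling R) (torus_pi a)) - 2 * pi / e <=
  \sum_(i < n.+1) truncated_psi e c (iter i (@doubling R) (periodic_point n k)).
Proof.
move=> e0; set b := k%:~R / _ => ab.
have -> : 2 * pi / e = \sum_(i < n.+1) 2 * pi / e * (2 ^+ i / mersenne n).
  rewrite -mulr_sumr -mulr_suml.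
  have -> : \sum_(i < n.+1) 2 ^+ i = mersenne n.
    by rewrite /mersenne subrX1 [2 - 1](_ : _ = 1) ?mul1r//; lra.
  by rewrite divff ?mulr1// gt_eqF// mersenne_gt0.
rewrite -sumrB; apply: ler_sum => i _; rewrite !iter_doubling -!torus_piMn.
apply: le_trans (truncated_psi_lipschitz c (a *+ 2 ^ i) (b *+ 2 ^ i) e0).
rewrite lerB// ler_wpM2l ?divr_ge0 ?mulr_ge0 ?pi_ge0 ?(ltW e0)//.
by rewrite -mulrnBl normrMn -[_ *+ (2 ^ i)]mulr_natl natrX ler_wpM2l.
Qed.

End periodic_points.

(** * Bounds on the pressure *)

Lemma lee_wnM2l (R : realType) (r : R) (x y : \bar R) :
  r <= 0 -> (x <= y)%E -> (r%:E * y <= r%:E * x)%E.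
Proof.
move=> r0 xy; rewrite -leeN2 -!mulNe -EFinN lee_wpmul2l//.
by rewrite lee_fin oppr_ge0.
Qed.

Section pressure.
Variable R : realType.
Implicit Types (c : torus R) (t : R).

Lemma measurable_scaled_psi t c : measurable_fun setT (fun x => (t%:E * psi c x)%E).
Proof. by apply: measurable_funeM; exact: measurable_psi. Qed.

Lemma scaled_psi_ge0 t c x : t < 0 -> (0 <= t%:E * psi c x)%E.
Proof. by move=> t0; rewrite mule_le0 ?psi_le0// lee_fin ltW. Qed.

Lemma truncated_le_scaled_psi t e c x : t < 0 -> 0 < e ->
  ((- t * truncated_psi e c x)%:E <= t%:E * psi c x)%E.
Proof.
move=> t0 e0; rewrite EFinM EFinN mulNe -muleN -EFinN.
exact: lee_wnM2l (ltW t0) (psi_le_truncated c x e0).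
Qed.

Lemma integral_scaled_psi (mu : probability (torus R) R) t c : t < 0 ->
  (\int[mu]_x (t%:E * psi c x) = t%:E * \int[mu]_x psi c x)%E.
Proof.
move=> t0; rewrite integral_psiN muleN -mulNe -EFinN -ge0_integralZl//.
- by apply: eq_integral => x _; rewrite EFinN muleNN.
- by apply: measurableT_comp => //; exact: measurable_psi.
- by move=> x _; rewrite oppe_ge0 psi_le0.
- by rewrite lee_fin oppr_ge0 ltW.
Qed.

(** The complement of the finite orbit is an open neighbourhood of [c] of measure 0. *)
Lemma orbit_measure_avoiding c n y :
  iter n.+1 (@doubling R) y = y ->
  (forall i, (i <= n)%N -> iter i (@doubling R) y != c) ->
  inv_measures_avoiding c (orbit_measure R (@doubling R) n y).
Proof.
move=> yper yc; split; first exact: orbit_measure_invariant.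
pose U := \big[setI/setT]_(i < n.+1) [set x | x != iter i (@doubling R) y].
have Uo : open U.
  by rewrite /U; elim/big_ind: _ => [|A B|i _]; [exact: openT|exact: openI|exact: open_torus_neq].
have Uc : U c.
  rewrite /U; elim/big_ind: _ => // i _ /=.
  by rewrite eq_sym yc// -ltnS.
move=> /(_ U Uo Uc); rewrite [X in (0 < X)%E](_ : _ = 0%E) ?ltxx//.
rewrite [LHS]orbit_measureE big1 ?mule0// => i _.
rewrite diracE memNset// /U (bigD1 i)//= => -[/eqP]; exact.
Qed.

Lemma pressure_ge c t (M : R) : t < 0 -> C_infty c -> ((- t * M)%:E <= pressure c t)%E.
Proof.
move=> t0 cC.
(* The extra 1 pays for the shadowing error. *)
have [_ [mu muT <-] muM] : exists2 z,
    [set (\int[mu]_x psi c x)%E | mu in @inv_measures R] z & (z < (- (M + 1))%:E)%E.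
  by apply: ereal_inf_lt; rewrite [X in (X < _)%E]cC ltNyr.
have [e [e01 Me]] := truncated_integral_gt muM.
have e0 : 0 < e by case/andP: e01.
have [n0 avoid] := periodic_point_avoiding c.
(* Large enough for the avoidance of [c], and for the shadowing error averaged over [n + 1] points
   to be at most 1. *)
pose n := maxn n0 (Num.truncn (2 * pi / e)).
have en : 2 * pi / e <= n.+1%:R.
  by rewrite (le_trans (ltW (truncnS_gt _)))// ler_nat ltnS leq_maxr.
have [x xM] := exists_large_birkhoff_sum n.+1 muT e01 Me.
(* The lift of [x] lies between [k / mersenne n] and [(k + 1) / mersenne n], so either numerator
   gives a point close enough to shadow. *)
pose k := Num.floor (torus_lift x * mersenne R n).
have [k' kk' k'c] := avoid n k (leq_maxl _ _).
have Mn0 := mersenne_gt0 R n.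
have := floor_itv (torus_lift x * mersenne R n); rewrite -/k intrD => kM.
have xk' : `|torus_lift x - k'%:~R / mersenne R n| <= (mersenne R n)^-1.
  rewrite -(ler_pM2r Mn0) -{2}[mersenne R n]gtr0_norm// -normrM mulrBl divfK ?gt_eqF//.
  rewrite mulVf ?gt_eqF//.
  by case/orP: kk' => /eqP->; rewrite ?intrD ler_norml; lra.
have := periodic_shadowing c e0 xk'; rewrite torus_liftK.
set y := periodic_point R n k' => ysum.
have yper : iter n.+1 (@doubling R) y = y.
  by apply/iter_doubling_periodic/periodic_pointMn.
apply: (@le_trans _ _ (ks_entropy (orbit_measure R (@doubling R) n y) (@doubling R) +
    \int[orbit_measure R (@doubling R) n y]_x (t%:E * psi c x))%E); last first.
  apply: ereal_sup_ubound; exists (orbit_measure R (@doubling R) n y) => //.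
  exact: orbit_measure_avoiding.
rewrite -[leLHS]add0e; apply: leeD; first exact: ks_entropy_ge0.
rewrite integral_orbit_measure; last 2 first.
- exact: measurable_scaled_psi.
- by move=> z; exact: scaled_psi_ge0.
apply: (@le_trans _ _ (n.+1%:R^-1%:E * \sum_(i < n.+1)
    (- t * truncated_psi e c (iter i (@doubling R) y))%:E)%E); last first.
  rewrite lee_pmul2l ?lte_fin//; apply: lee_sum => i _.
  exact: truncated_le_scaled_psi.
rewrite sumEFin -EFinM lee_fin -mulr_sumr mulrCA ler_pM2l ?oppr_gt0//.
rewrite mulrC ler_pdivlMr//; lra.
Qed.

Lemma pressure_le c t (A : R) : t < 0 ->
  (forall mu, @inv_measures R mu -> (A%:E <= \int[mu]_x psi c x)%E) ->
  (pressure c t <= (3 * ln 2 + 1 + t * A)%:E)%E.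
Proof.
move=> t0 psiA; apply: ge_ereal_sup => _ [mu [muT _] <-].
rewrite EFinD; apply: leeD; first exact: ks_entropy_doubling_le.
rewrite integral_scaled_psi// EFinM.
exact: lee_wnM2l (ltW t0) (psiA _ muT).
Qed.

End pressure.

Theorem proposition2p1 (R : realType) (t : R) (c : torus R) (ht : t < 0) :
  pressure c t = +oo%E <-> C_infty c.
Proof.
split=> [pc|cC]; last first.
  apply: eq_infty => r; have := pressure_ge (r / - t) ht cC.
  by rewrite mulrC divfK// oppr_eq0 lt_eqF.
apply: contrapT => /eqP ncC.
have [A psiA] : exists A : R, forall mu, @inv_measures R mu ->
    (A%:E <= \int[mu]_x psi c x)%E.
  (* If [alpha c] is real it is the bound sought; if it is [+oo], every integral is [+oo] and the
     default value of [fine] serves. *)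
  exists (fine (alpha c)) => mu muT.
  have : (alpha c <= \int[mu]_x psi c x)%E by apply: ereal_inf_lbound; exists mu.
  case: (alpha c) ncC => [//|_|//].
  by rewrite leye_eq => /eqP->; rewrite leey.
by have := pressure_le ht psiA; rewrite pc leye_eq.
Qed.
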